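(* Let $L/k$ be a finite Galois extension with group $\Gamma$, let $T$ be an algebraic $k$-torus split over $L$ with character module $M$, and let $A_Q=L_Q[M]^\Gamma$ be a quantum form of $T$, where $L_Q[M]=A_Q\otimes_kL$. Let $Z_Q$ be the center of $A_Q$ and $Z_Q[M]$ the center of $L_Q[M]$. Then $Z_Q=Z_Q[M]^\Gamma$.
   Context: For a matrix $Q=(q_{ij})_{i,j=1}^n$ with $q_{ij}\in L^*$, $q_{ij}q_{ji}=q_{ii}=1$, $L_Q[M]=L_Q[x_1^{\pm1},\dots,x_n^{\pm1}]$ denotes the $L$-algebra generated by $x_1^{\pm1},\dots,x_n^{\pm1}$ with relations $x_ix_j=q_{ij}x_jx_i$. Here $M$ is the character group of $T$, free abelian of rank $n$ with $\Gamma$-action, and $t_1,\dots,t_n$ is a basis of $M$, so $L[T]=L[t_1^{\pm1},\dots,t_n^{\pm1}]$. A quantum form of $T$ is a $k$-algebra $A_Q$ such that (1) $A_Q\otimes_kL=L_Q[x_1^{\pm1},\dots,x_n^{\pm1}]$, and (2) there is a coaction $R:A_Q\to k[T]\otimes_kA_Q$ of the Hopf algebra $k[T]$ whose extension $R_L=R\otimes1$ to $L$ is the algebra homomorphism with $R_L(x_i)=t_i\otimes x_i$. The group $\Gamma$ acts on $L_Q[M]=A_Q\otimes_kL$ through the second factor, by ring automorphisms that are semilinear over $L$, and $A_Q=L_Q[M]^\Gamma$. This action preserves the center $Z_Q[M]$; $(\cdot)^\Gamma$ denotes $\Gamma$-invariants. *)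

(* Defs.v *)
From HB Require Import structures.
From mathcomp Require Import all_boot all_order all_algebra all_fingroup all_field.
From mathcomp Require Import boolp classical_sets.

Set Implicit Arguments.
Unset Strict Implicit.
Unset Printing Implicit Defensive.

Import GRing.Theory.
Local Open Scope quotient_scope.
Local Open Scope ring_scope.

Local Notation bilinear f := (bilinear_for *:%R *:%R f).

(* A vector v != 0 takes the value 1 under some linear form; this makes the
   tensor product of two nonzero algebras a nonzero ring. *)
Lemma linear_form_exists (k : fieldType) (V : lmodType k) (v : V) :
  v != 0 -> exists phi : V -> k^o, linear phi /\ phi v = 1.
Proof.
move=> v0.
pose P (W : set V) := (forall c x y, W x -> W y -> W (c *: x + y)) /\ ~ W v.
have [|W [[Wlin Wv] Wmax]] := @Zorn_bigcup V P.
  move=> F FP Ftot; split; last by move=> [X FX Xv]; have [_] := FP _ FX.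
  move=> c x y [X FX Xx] [Y FY Yy].
  have [XY|YX] := Ftot _ _ FX FY.
    by exists Y => //; have [h _] := FP _ FY; apply: h => //; apply: XY.
  by exists X => //; have [h _] := FP _ FX; apply: h => //; apply: YX.
have W0 : W 0.
  apply: contrapT => nW0.
  have W_empty x : ~ W x.
    by move=> Wx; apply: nW0; have := Wlin (-1) x x Wx Wx; rewrite scaleN1r addNr.
  apply: (Wmax [set 0]%classic).
    by split=> [x /W_empty//|] /(_ 0 erefl).
  split=> [c x y -> ->|/= v0']; first by rewrite /= scaler0 addr0.
  by rewrite v0' eqxx in v0.
have WZ c x : W x -> W (c *: x).
  by move=> Wx; rewrite -[X in W X]addr0; apply: Wlin.
have WD x y : W x -> W y -> W (x + y).
  by move=> Wx Wy; rewrite -[x]scale1r; apply: Wlin.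
have coef x : exists c, W (x - c *: v).
  apply: contrapT => nx.
  have nWx : ~ W x by move=> Wx; apply: nx; exists 0; rewrite scale0r subr0.
  pose W' : set V := [set y | exists c, W (y - c *: x)]%classic.
  apply: (Wmax W').
    split; last by move=> /(_ x) h; apply/nWx/h; exists 1; rewrite scale1r subrr.
    by move=> y Wy; exists 0; rewrite scale0r subr0.
  split.
  - move=> c y z [a Wa] [b Wb]; exists (c * a + b).
    suff -> : c *: y + z - (c * a + b) *: x =
        c *: (y - a *: x) + (z - b *: x) by apply: Wlin.
    by rewrite scalerDl scalerBr scalerA opprD addrACA.
  - move=> [a Wa].
    have [a0|a0] := eqVneq a 0; first by apply: Wv; rewrite a0 scale0r subr0 in Wa.
    apply: nx; exists a^-1; have := WZ (- a^-1) _ Wa.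
    by rewrite scalerBr !scaleNr scalerA mulVf // scale1r opprK addrC.
have [phi phiP] := choice coef.
have phiU x c : W (x - c *: v) -> phi x = c.
  move=> Wc; apply/eqP; rewrite -subr_eq0; apply: contrapT => /negP d0.
  apply: Wv.
  have := WD _ _ Wc (WZ (-1) _ (phiP x)).
  have -> : x - c *: v + -1 *: (x - phi x *: v) = (phi x - c) *: v.
    by rewrite scaleN1r opprB addrCA addrAC subrr add0r scalerBl addrC.
  by move=> /(WZ (phi x - c)^-1); rewrite scalerA mulVf // scale1r.
exists phi; split; last by apply: phiU; rewrite scale1r subrr.
move=> c x y; apply: phiU.
suff -> : c *: x + y - (c * phi x + phi y) *: v =
    c *: (x - phi x *: v) + (y - phi y *: v) by apply: Wlin.
by rewrite scalerDl scalerBr scalerA opprD addrACA.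
Qed.

(* Tensor product over k: formal sums of pairs (a, b), standing for the sum of
   the a (x) b, where two formal sums are identified when no bilinear map
   separates them. *)
Section TensorDef.
Variables (k : fieldType) (A B : lmodType k).

Definition tens_eval (V : lmodType k) (f : A -> B -> V) (s : seq (A * B)) : V :=
  \sum_(p <- s) f p.1 p.2.

Definition tens_rel (s t : seq (A * B)) : bool :=
  `[< forall (V : lmodType k) (f : A -> B -> V),
        bilinear f -> tens_eval f s = tens_eval f t >].

Lemma tens_rel_equiv : equiv_class_of tens_rel.
Proof.
split=> [s|s t|t s u].
- by apply/asboolP.
- by apply/asboolP/asboolP => h V f bf; rewrite h.
- by move=> /asboolP h1 /asboolP h2; apply/asboolP => V f bf; rewrite h1 ?h2.
Qed.
Canonical tens_equiv := EquivRelPack tens_rel_equiv.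

Definition tens : Type := {eq_quot tens_equiv}.
HB.instance Definition _ := Choice.copy tens {eq_quot tens_equiv}.

Definition tens_of (s : seq (A * B)) : tens := \pi_({eq_quot tens_equiv})%qT s.
Definition tens_rep (x : tens) : seq (A * B) :=
  generic_quotient.repr (x : {eq_quot tens_equiv}).
Definition ptens (a : A) (b : B) : tens := tens_of [:: (a, b)].
Definition tens_lift (V : lmodType k) (f : A -> B -> V) (x : tens) : V :=
  tens_eval f (tens_rep x).

Lemma tens_repK x : tens_of (tens_rep x) = x.
Proof. exact: generic_quotient.reprK. Qed.

Lemma tens_lift_of (V : lmodType k) (f : A -> B -> V) s :
  bilinear f -> tens_lift f (tens_of s) = tens_eval f s.
Proof.
move=> bf.
have /eqmodP /asboolP h : (tens_rep (tens_of s) = s %[mod {eq_quot tens_equiv}])%qT.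
  exact: generic_quotient.reprK.
exact: h.
Qed.

Lemma tens_lift_inj (x y : tens) :
  (forall (V : lmodType k) (f : A -> B -> V), bilinear f ->
     tens_lift f x = tens_lift f y) -> x = y.
Proof.
move=> h; rewrite -[x]tens_repK -[y]tens_repK; apply/eqmodP/asboolP => V f bf.
exact: h.
Qed.

Definition tens_zero : tens := tens_of [::].
Definition tens_add (x y : tens) := tens_of (tens_rep x ++ tens_rep y).
Definition tens_scale (c : k) (x : tens) :=
  tens_of [seq (c *: p.1, p.2) | p <- tens_rep x].
Definition tens_opp (x : tens) := tens_scale (-1) x.

Section Lift.
Variables (V : lmodType k) (f : A -> B -> V).
Hypothesis bf : bilinear f.

Lemma tens_lift0 : tens_lift f tens_zero = 0.
Proof. by rewrite tens_lift_of // /tens_eval big_nil. Qed.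

Lemma tens_liftD x y :
  tens_lift f (tens_add x y) = tens_lift f x + tens_lift f y.
Proof. by rewrite tens_lift_of // /tens_eval big_cat. Qed.

Lemma tens_liftZ c x : tens_lift f (tens_scale c x) = c *: tens_lift f x.
Proof.
rewrite tens_lift_of // /tens_lift /tens_eval big_map scaler_sumr.
apply: eq_bigr => p _ /=.
have h0 : f 0 p.2 = 0.
  by have := bf.1 p.2 (-1) 0 0; rewrite scaler0 addr0 /= scaleN1r addNr.
by have := bf.1 p.2 c p.1 0; rewrite /= h0 !addr0.
Qed.

Lemma tens_liftN x : tens_lift f (tens_opp x) = - tens_lift f x.
Proof. by rewrite tens_liftZ scaleN1r. Qed.

Lemma tens_lift_ptens a b : tens_lift f (ptens a b) = f a b.
Proof. by rewrite tens_lift_of // /tens_eval big_seq1. Qed.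

End Lift.

Let liftE := (tens_lift0, tens_liftD, tens_liftN, tens_liftZ).

Fact tens_addA : associative tens_add.
Proof. by move=> x y z; apply: tens_lift_inj => V f bf; rewrite !liftE // addrA. Qed.
Fact tens_addC : commutative tens_add.
Proof. by move=> x y; apply: tens_lift_inj => V f bf; rewrite !liftE // addrC. Qed.
Fact tens_add0 : left_id tens_zero tens_add.
Proof. by move=> x; apply: tens_lift_inj => V f bf; rewrite !liftE // add0r. Qed.
Fact tens_addN : left_inverse tens_zero tens_opp tens_add.
Proof. by move=> x; apply: tens_lift_inj => V f bf; rewrite !liftE // addNr. Qed.

HB.instance Definition _ :=
  GRing.isZmodule.Build tens tens_addA tens_addC tens_add0 tens_addN.

Fact tens_scaleA a b x : tens_scale a (tens_scale b x) = tens_scale (a * b) x.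
Proof. by apply: tens_lift_inj => V f bf; rewrite !liftE // scalerA. Qed.
Fact tens_scale1 : left_id 1 tens_scale.
Proof. by move=> x; apply: tens_lift_inj => V f bf; rewrite !liftE // scale1r. Qed.
Fact tens_scaleDr : right_distributive tens_scale +%R.
Proof.
by move=> c x y; apply: tens_lift_inj => V f bf; rewrite !liftE // scalerDr.
Qed.
Fact tens_scaleDl x : {morph tens_scale^~ x : a b / a + b}.
Proof.
by move=> a b; apply: tens_lift_inj => V f bf; rewrite !liftE // scalerDl.
Qed.

HB.instance Definition _ := GRing.Zmodule_isLmodule.Build k tens
  tens_scaleA tens_scale1 tens_scaleDr tens_scaleDl.

Lemma tens_lift_linear (V : lmodType k) (f : A -> B -> V) :
  bilinear f -> linear (tens_lift f).
Proof. by move=> bf c x y; rewrite tens_liftD // tens_liftZ. Qed.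

Lemma ptens_bilinear : bilinear ptens.
Proof.
split=> [b|a] c x y /=; apply: tens_lift_inj => V f bf.
  by rewrite tens_liftD // tens_liftZ // !tens_lift_ptens //; apply: bf.1.
by rewrite tens_liftD // tens_liftZ // !tens_lift_ptens //; apply: bf.2.
Qed.

Lemma tens_ind (P : tens -> Prop) :
  P 0 -> (forall x y, P x -> P y -> P (x + y)) ->
  (forall a b, P (ptens a b)) -> forall x, P x.
Proof.
move=> P0 PD Pp x; rewrite -[x]tens_repK.
elim: (tens_rep x) => [|[a b] s IHs]; first exact: P0.
suff -> : tens_of ((a, b) :: s) = ptens a b + tens_of s by apply: PD.
apply: tens_lift_inj => V f bf.
by rewrite tens_liftD // !tens_lift_of // /tens_eval big_cons big_seq1.
Qed.

End TensorDef.

Notation "a ⊗ b" := (ptens a b) (at level 40, left associativity) : ring_scope.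

Section TensorAlg.
Variables (k : fieldType) (A B : algType k).
Implicit Types x y z : tens A B.

Definition tens_lmul (a : A) (b : B) : tens A B -> tens A B :=
  tens_lift (fun a' b' => (a * a') ⊗ (b * b')).
Definition tens_mul x y : tens A B := tens_lift (fun a b => tens_lmul a b y) x.
Definition tens_one : tens A B := 1 ⊗ 1.

Let bmul_r (a : A) (b : B) :
  bilinear (fun a' b' => (a * a') ⊗ (b * b') : tens A B).
Proof.
split=> [b'|a'] c u v /=; rewrite mulrDr -scalerAr.
  exact: (ptens_bilinear A B).1.
exact: (ptens_bilinear A B).2.
Qed.

Let bmul_l y : bilinear (fun a b => tens_lmul a b y).
Proof.
split=> [b|a] c u v /=; elim/tens_ind: y => [|y z IHy IHz|a' b'].
- by rewrite /tens_lmul !tens_lift0 // scaler0 addr0.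
- by rewrite /tens_lmul !tens_liftD // -!/(tens_lmul _ _ _) IHy IHz scalerDr addrACA.
- rewrite /tens_lmul !tens_lift_ptens // mulrDl -scalerAl.
  exact: (ptens_bilinear A B).1.
- by rewrite /tens_lmul !tens_lift0 // scaler0 addr0.
- by rewrite /tens_lmul !tens_liftD // -!/(tens_lmul _ _ _) IHy IHz scalerDr addrACA.
- rewrite /tens_lmul !tens_lift_ptens // mulrDl -scalerAl.
  exact: (ptens_bilinear A B).2.
Qed.

Fact tens_mulDl : left_distributive tens_mul +%R.
Proof. by move=> x y z; rewrite /tens_mul tens_liftD. Qed.

Let tens_mulZl c x y : tens_mul (c *: x) y = c *: tens_mul x y.
Proof. by rewrite /tens_mul tens_liftZ. Qed.

Let tens_mul0l y : tens_mul 0 y = 0.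
Proof. by rewrite /tens_mul tens_lift0. Qed.

Let tens_mulpE a b y : tens_mul (a ⊗ b) y = tens_lmul a b y.
Proof. by rewrite /tens_mul tens_lift_ptens. Qed.

Let tens_mulZr c x y : tens_mul x (c *: y) = c *: tens_mul x y.
Proof.
elim/tens_ind: x => [|x z IHx IHz|a b].
- by rewrite !tens_mul0l scaler0.
- by rewrite !tens_mulDl IHx IHz scalerDr.
- by rewrite !tens_mulpE /tens_lmul tens_liftZ.
Qed.

Fact tens_mulDr : right_distributive tens_mul +%R.
Proof.
move=> x y z; elim/tens_ind: x => [|x t IHx IHt|a b].
- by rewrite !tens_mul0l addr0.
- by rewrite !tens_mulDl IHx IHt addrACA.
- by rewrite !tens_mulpE /tens_lmul tens_liftD.
Qed.

Let tens_mul0r x : tens_mul x 0 = 0.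
Proof. by have := tens_mulZr 0 x 0; rewrite !scale0r. Qed.

Fact tens_mul_ptens a b a' b' :
  tens_mul (a ⊗ b) (a' ⊗ b') = (a * a') ⊗ (b * b').
Proof. by rewrite tens_mulpE /tens_lmul tens_lift_ptens. Qed.

Fact tens_mulA : associative tens_mul.
Proof.
move=> x y z; elim/tens_ind: x => [|x t IHx IHt|a b].
- by rewrite !tens_mul0l.
- by rewrite !tens_mulDl IHx IHt.
elim/tens_ind: y => [|y t IHy IHt|a' b'].
- by rewrite !(tens_mul0l, tens_mul0r).
- by rewrite !(tens_mulDl, tens_mulDr) IHy IHt.
elim/tens_ind: z => [|z t IHz IHt|a'' b''].
- by rewrite !tens_mul0r.
- by rewrite !tens_mulDr IHz IHt.
- by rewrite !tens_mul_ptens !mulrA.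
Qed.

Fact tens_mul1l : left_id tens_one tens_mul.
Proof.
move=> x; elim/tens_ind: x => [|x y IHx IHy|a b].
- by rewrite tens_mul0r.
- by rewrite tens_mulDr IHx IHy.
- by rewrite tens_mul_ptens !mul1r.
Qed.

Fact tens_mul1r : right_id tens_one tens_mul.
Proof.
move=> x; elim/tens_ind: x => [|x y IHx IHy|a b].
- by rewrite tens_mul0l.
- by rewrite tens_mulDl IHx IHy.
- by rewrite tens_mul_ptens !mulr1.
Qed.

Fact tens_one_neq0 : tens_one != 0.
Proof.
have [phi [lphi phi1]] := linear_form_exists (oner_neq0 A).
have [psi [lpsi psi1]] := linear_form_exists (oner_neq0 B).
pose f a b : k^o := phi a * psi b.
have bf : bilinear f.
  split=> [b|a] c x y; rewrite /f /=; first by rewrite lphi mulrDl -scalerAl.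
  by rewrite lpsi mulrDr -scalerAr.
apply: contra_neq (oner_neq0 k) => /(congr1 (tens_lift f)).
by rewrite tens_lift_ptens // tens_lift0 // /f phi1 psi1 mulr1.
Qed.

HB.instance Definition _ := GRing.Zmodule_isNzRing.Build (tens A B)
  tens_mulA tens_mul1l tens_mul1r tens_mulDl tens_mulDr tens_one_neq0.

Fact tens_scaleAl (c : k) x y : c *: (x * y) = (c *: x) * y.
Proof. by rewrite [RHS]tens_mulZl. Qed.
Fact tens_scaleAr (c : k) x y : c *: (x * y) = x * (c *: y).
Proof. by rewrite [RHS]tens_mulZr. Qed.

HB.instance Definition _ :=
  GRing.Lmodule_isLalgebra.Build k (tens A B) tens_scaleAl.
HB.instance Definition _ :=
  GRing.Lalgebra_isAlgebra.Build k (tens A B) tens_scaleAr.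

Lemma tens_mulp (a a' : A) (b b' : B) :
  (a ⊗ b) * (a' ⊗ b') = (a * a') ⊗ (b * b').
Proof. exact: tens_mul_ptens. Qed.

End TensorAlg.

Section TensorMaps.
Variable k : fieldType.

Definition tens_map (A A' B B' : lmodType k) (f : A -> A') (g : B -> B') :
  tens A B -> tens A' B' := tens_lift (fun a b => f a ⊗ g b).

Definition tens_assoc (A B C : lmodType k) :
    tens (tens A B) C -> tens A (tens B C) :=
  tens_lift (fun (x : tens A B) c => tens_lift (fun a b => a ⊗ (b ⊗ c)) x).

Definition tens_prod (A : algType k) : tens A A -> A :=
  tens_lift (fun a b : A => a * b).

End TensorMaps.

(* The L-algebra obtained from tens A L by letting L act on the second factor. *)
Section BaseChange.
Variables (k : fieldType) (A : algType k) (L : fieldExtType k).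

Definition base_change : Type := tens A L.
HB.instance Definition _ := GRing.NzRing.copy base_change (tens A L).

Definition bc_scale (l : L) : base_change -> base_change :=
  tens_map (id : A -> A) (fun l' : L => l * l').

Let bc_bilinear (l : L) : bilinear (fun a l' => a ⊗ (l * l') : tens A L).
Proof.
split=> [l'|a] c u v /=; first exact: (ptens_bilinear A L).1.
by rewrite mulrDr -scalerAr; apply: (ptens_bilinear A L).2.
Qed.

Let bc_scale_p l a l' : bc_scale l (a ⊗ l') = a ⊗ (l * l').
Proof. exact: (tens_lift_ptens (bc_bilinear l)). Qed.

Let bc_scale0 l : bc_scale l 0 = 0.
Proof. exact: (tens_lift0 (bc_bilinear l)). Qed.

Let bc_scaleD l : {morph bc_scale l : x y / x + y}.
Proof. exact: (tens_liftD (bc_bilinear l)). Qed.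

Fact bc_scaleA a b x : bc_scale a (bc_scale b x) = bc_scale (a * b) x.
Proof.
elim/tens_ind: x => [|x y IHx IHy|u v]; first by rewrite !bc_scale0.
  by rewrite !bc_scaleD IHx IHy.
by rewrite !bc_scale_p mulrA.
Qed.

Fact bc_scale1 : left_id 1 bc_scale.
Proof.
move=> x; elim/tens_ind: x => [|x y IHx IHy|u v]; first by rewrite bc_scale0.
  by rewrite bc_scaleD IHx IHy.
by rewrite bc_scale_p mul1r.
Qed.

Fact bc_scaleDr : right_distributive bc_scale +%R.
Proof. by move=> l x y; rewrite bc_scaleD. Qed.

Fact bc_scaleDl x : {morph bc_scale^~ x : a b / a + b}.
Proof.
move=> a b; elim/tens_ind: x => [|x y IHx IHy|u v].
- by rewrite !bc_scale0 addr0.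
- by rewrite !bc_scaleD IHx IHy addrACA.
rewrite !bc_scale_p mulrDl.
have := (ptens_bilinear A L).2 u 1 (a * v) (b * v).
by rewrite /= !scale1r; apply.
Qed.

HB.instance Definition _ := GRing.Zmodule_isLmodule.Build L base_change
  bc_scaleA bc_scale1 bc_scaleDr bc_scaleDl.

Fact bc_scaleAl (l : L) (x y : base_change) : l *: (x * y) = (l *: x) * y.
Proof.
suff h (u v : tens A L) : bc_scale l (u * v) = (bc_scale l u : tens A L) * v.
  exact: h.
elim/tens_ind: u => [|u t IHu IHt|a b].
- by rewrite !(bc_scale0, mul0r).
- by rewrite mulrDl !bc_scaleD mulrDl IHu IHt.
elim/tens_ind: v => [|v t IHv IHt|a' b'].
- by rewrite !mulr0 bc_scale0.
- by rewrite !mulrDr !bc_scaleD IHv IHt.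
by rewrite bc_scale_p !tens_mulp bc_scale_p mulrA.
Qed.

Fact bc_scaleAr (l : L) (x y : base_change) : l *: (x * y) = x * (l *: y).
Proof.
suff h (u v : tens A L) : bc_scale l (u * v) = u * (bc_scale l v : tens A L).
  exact: h.
elim/tens_ind: u => [|u t IHu IHt|a b].
- by rewrite !mul0r bc_scale0.
- by rewrite !mulrDl !bc_scaleD IHu IHt.
elim/tens_ind: v => [|v t IHv IHt|a' b'].
- by rewrite bc_scale0 !mulr0 bc_scale0.
- by rewrite mulrDr !bc_scaleD mulrDr IHv IHt.
by rewrite bc_scale_p !tens_mulp bc_scale_p mulrCA.
Qed.

HB.instance Definition _ :=
  GRing.Lmodule_isLalgebra.Build L base_change bc_scaleAl.
HB.instance Definition _ :=
  GRing.Lalgebra_isAlgebra.Build L base_change bc_scaleAr.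

Definition bc_in (a : A) : base_change := a ⊗ (1 : L).

Lemma bc_in_inj : injective bc_in.
Proof.
have [psi [lpsi psi1]] := linear_form_exists (oner_neq0 L).
pose f (a : A) (l : L) : A := (psi l : k) *: a.
have bf : bilinear f.
  split=> [l|a] c x y; rewrite /f /=; first by rewrite scalerDr !scalerA mulrC.
  by rewrite lpsi scalerDl scalerA.
move=> a a' /(congr1 (tens_lift f)).
by rewrite /bc_in !tens_lift_ptens // /f psi1 !scale1r.
Qed.

End BaseChange.

Arguments bc_in {k A} L a.

Section BaseChangeMaps.
Variables (k : fieldType) (L : fieldExtType k).

Definition bc_map (A B : algType k) (f : A -> B) :
  base_change A L -> base_change B L := tens_map f (id : L -> L).

(* The image of x (x)_L y under the canonical isomorphism
     (A (x)_k L) (x)_L (B (x)_k L) = (A (x)_k B) (x)_k L,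
   (a (x) l) (x) (b (x) l') |-> (a (x) b) (x) l l'. *)
Definition bc_tens (A B : algType k) (x : base_change A L)
    (y : base_change B L) : base_change (tens A B) L :=
  bc_map (fun a : A => a ⊗ (1 : B)) x * bc_map (fun b : B => (1 : A) ⊗ b) y.

End BaseChangeMaps.

(* B is the L-algebra presented by generators x_i and their inverses y_i, subject to
   x_i x_j = q_ij x_j x_i.  For q_ij = 1 this is the Laurent polynomial algebra. *)
Section QuantumTorus.
Variables (L : fieldType) (n : nat) (Q : 'M[L]_n).

Definition quantum_relations (B : algType L) (x y : 'I_n -> B) : Prop :=
  [/\ forall i, x i * y i = 1, forall i, y i * x i = 1 &
      forall i j, x i * x j = Q i j *: (x j * x i)].

Definition is_quantum_torus (B : algType L) (x y : 'I_n -> B) : Prop :=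
  quantum_relations x y /\
  forall (C : algType L) (u v : 'I_n -> C), quantum_relations u v ->
    exists f : {lrmorphism B -> C}, (forall i, f (x i) = u i) /\
      forall g : {lrmorphism B -> C}, (forall i, g (x i) = u i) -> g =1 f.

End QuantumTorus.

Record commHopfAlgebra (k : fieldType) := CommHopfAlgebra {
  hopf_sort :> comAlgType k;
  hopf_comul : {lrmorphism hopf_sort -> tens hopf_sort hopf_sort};
  hopf_counit : {lrmorphism hopf_sort -> k^o};
  hopf_antipode : {linear hopf_sort -> hopf_sort};
  hopf_coassoc : forall h,
    tens_assoc (tens_map hopf_comul (id : hopf_sort -> hopf_sort)
                 (hopf_comul h)) =
    tens_map (id : hopf_sort -> hopf_sort) hopf_comul (hopf_comul h);
  hopf_counitl : forall h,
    tens_map hopf_counit (id : hopf_sort -> hopf_sort) (hopf_comul h) =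
    (1 : k^o) ⊗ h;
  hopf_counitr : forall h,
    tens_map (id : hopf_sort -> hopf_sort) hopf_counit (hopf_comul h) =
    h ⊗ (1 : k^o);
  hopf_antipodel : forall h,
    tens_prod (tens_map hopf_antipode (id : hopf_sort -> hopf_sort)
                (hopf_comul h)) = (hopf_counit h : k)%:A;
  hopf_antipoder : forall h,
    tens_prod (tens_map (id : hopf_sort -> hopf_sort) hopf_antipode
                (hopf_comul h)) = (hopf_counit h : k)%:A
}.

Section Torus.
Variables (k : fieldType) (L : fieldExtType k).

(* The characters of T defined over L, i.e. the elements of M, are the group-like
   elements of L[T] = k[T] (x)_k L. *)
Definition is_character (H : commHopfAlgebra k) (chi : base_change H L) : Prop :=
  bc_map (@hopf_comul k H) chi = bc_tens chi chi /\
  bc_map (@hopf_counit k H) chi = 1.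

Definition laurent_monomial (B : nzRingType) n (t t' : 'I_n -> B)
    (m : {ffun 'I_n -> int}) : B :=
  \prod_(i < n) match m i with Posz p => t i ^+ p | Negz p => t' i ^+ p.+1 end.

(* A k-torus of rank n split over L, given by its coordinate Hopf algebra k[T],
   with a chosen basis t_1, ..., t_n of its character group M. *)
Record splitTorus (n : nat) := SplitTorus {
  torus_hopf :> commHopfAlgebra k;
  torus_t : 'I_n -> base_change torus_hopf L;
  torus_tV : 'I_n -> base_change torus_hopf L;
  torus_split : is_quantum_torus (const_mx 1) torus_t torus_tV;
  torus_char : forall i, is_character (torus_t i);
  torus_basis : forall chi, is_character chi ->
    exists! m, chi = laurent_monomial torus_t torus_tV m
}.

Definition is_coaction (H : commHopfAlgebra k) (A : algType k)
    (R : A -> tens H A) : Prop :=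
  (forall a, tens_assoc (tens_map (@hopf_comul k H) (id : A -> A) (R a)) =
             tens_map (id : H -> H) R (R a)) /\
  (forall a, tens_map (@hopf_counit k H) (id : A -> A) (R a) = (1 : k^o) ⊗ a).

(* The generators x_i are elements of A (x)_k L, not of A.  R_L = R (x) 1 is L-linear by
   construction, so qform_coactM makes it a homomorphism of L-algebras. *)
Record quantumForm n (T : splitTorus n) (Q : 'M[L]_n) := QuantumForm {
  qform_sort :> algType k;
  qform_x : 'I_n -> base_change qform_sort L;
  qform_xV : 'I_n -> base_change qform_sort L;
  qform_split : is_quantum_torus Q qform_x qform_xV;
  qform_coact : {linear qform_sort -> tens T qform_sort};
  qform_coactP : is_coaction qform_coact;
  qform_coactM : monoid_morphism (bc_map (L := L) qform_coact);
  qform_coact_x : forall i,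
    bc_map (L := L) qform_coact (qform_x i) = bc_tens (torus_t T i) (qform_x i)
}.

End Torus.

Definition center (B : nzRingType) : set B :=
  [set z | forall y, z * y = y * z]%classic.

Arguments center : clear implicits.

(* For A a quantum form with A (x)_k L = L_Q[M], the identification
   A = L_Q[M]^Gamma is the embedding bc_in L : a |-> a (x) 1. *)
Definition gal_act (k : fieldType) (L : splittingFieldType k) (A : algType k)
    (s : gal_of {:L}) : base_change A L -> base_change A L :=
  tens_map (id : A -> A) (s : L -> L).

Definition gal_invariants (k : fieldType) (L : splittingFieldType k)
    (A : algType k) : set (base_change A L) :=
  [set z | forall s, s \in 'Gal({:L} / 1)%g -> gal_act s z = z]%classic.

Arguments gal_invariants {k} L A.

(* Main.v *)
Require Import Defs.
From mathcomp Require Import all_boot all_order all_algebra all_fingroup all_field.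
From mathcomp Require Import boolp classical_sets.
Import GRing.Theory.
Local Open Scope ring_scope.
Local Open Scope classical_set_scope.

(** Only Galois descent for [A (x) L] matters: for [w] invariant and [l] of
    trace 1, [w = Tr(l) w = sum_s s(l w)], and on pure tensors
    [sum_s s(a (x) l') = a (x) Tr(l') = Tr(l') a (x) 1], so that [w] lies in
    the image of [A].  Centrality passes between [A] and [A (x) L] because
    [A -> A (x) L] is an injective ring morphism and [a (x) 1] commutes with
    [1 (x) L]. *)

Section GaloisDescent.
Variables (k : fieldType) (L : splittingFieldType k) (A : algType k).
Implicit Types (a : A) (l : L) (s : gal_of {:L}) (w : base_change A L).

(** This is [tens_ind] retyped at [base_change A L], so that after [elim] scaling is the action of
    [L] on the second factor, not that of [k] on [tens A L]. *)
Lemma base_change_ind (P : base_change A L -> Prop) :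
  P 0 -> (forall x y, P x -> P y -> P (x + y)) ->
  (forall a l, P (a ⊗ l : tens A L)) -> forall w, P w.
Proof. exact: tens_ind. Qed.

Lemma ptensDr a l l' : a ⊗ (l + l') = a ⊗ l + a ⊗ l' :> tens A L.
Proof. by have := (ptens_bilinear A L).2 a 1 l l'; rewrite /= !scale1r. Qed.

Lemma ptensDl a a' l : (a + a') ⊗ l = a ⊗ l + a' ⊗ l :> tens A L.
Proof. by have := (ptens_bilinear A L).1 l 1 a a'; rewrite /= !scale1r. Qed.

Lemma ptens0r a : a ⊗ (0 : L) = 0 :> tens A L.
Proof. by apply: (addrI (a ⊗ (0 : L))); rewrite -ptensDr !addr0. Qed.

Lemma ptens0l l : (0 : A) ⊗ l = 0 :> tens A L.
Proof. by apply: (addrI ((0 : A) ⊗ l)); rewrite -ptensDl !addr0. Qed.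

Lemma ptens_scale_swap (c : k) a l : a ⊗ (c *: l) = (c *: a) ⊗ l :> tens A L.
Proof.
have := (ptens_bilinear A L).2 a c l 0; have := (ptens_bilinear A L).1 l c a 0.
by rewrite /= !addr0 ptens0l ptens0r !addr0 => -> ->.
Qed.

Lemma bc_in_mul a a' : bc_in L (a * a') = bc_in L a * bc_in L a'.
Proof. by have := tens_mulp a a' (1 : L) 1; rewrite mulr1 => h; exact: esym h. Qed.

Lemma bc_scale_ptens l a l' :
  l *: (a ⊗ l' : base_change A L) = (a ⊗ (l * l') : tens A L).
Proof.
rewrite /GRing.scale /= /bc_scale /tens_map tens_lift_ptens //.
split=> [b|b] c u v /=; first exact: (ptens_bilinear A L).1.
by rewrite mulrDr -scalerAr; apply: (ptens_bilinear A L).2.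
Qed.

(** Holds since [s] is [k]-linear; bilinearity is what lets [tens_lift] compute on sums and pure
    tensors. *)
Lemma gal_bilinear s :
  bilinear_for *:%R *:%R (fun a l => a ⊗ s l : tens A L).
Proof.
split=> [l|a] c u v /=; first exact: (ptens_bilinear A L).1.
by rewrite linearP; apply: (ptens_bilinear A L).2.
Qed.

Lemma gal_act_ptens s a l : gal_act s (a ⊗ l) = (a ⊗ s l : tens A L).
Proof. by rewrite /gal_act /tens_map (tens_lift_ptens (gal_bilinear s)). Qed.

Lemma gal_act0 s : gal_act s 0 = 0 :> base_change A L.
Proof. exact: (tens_lift0 (gal_bilinear s)). Qed.

Lemma gal_actD s w w' : gal_act s (w + w') = gal_act s w + gal_act s w'.
Proof. exact: (tens_liftD (gal_bilinear s)). Qed.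

(** Semilinearity comes from multiplicativity of [s] on the second factor. *)
Lemma gal_act_scale s l w : gal_act s (l *: w) = s l *: gal_act s w.
Proof.
elim/base_change_ind: w => [|x y IHx IHy|a l'].
- by rewrite scaler0 gal_act0 scaler0.
- by rewrite scalerDr !gal_actD IHx IHy scalerDr.
- by rewrite bc_scale_ptens !gal_act_ptens bc_scale_ptens rmorphM.
Qed.

Lemma gal_act_bc_in s a : gal_act s (bc_in L a) = bc_in L a.
Proof. by rewrite gal_act_ptens rmorph1. Qed.

Hypothesis galL : galois 1 {:L}.

Lemma galTrace_in_base l : exists c : k, galTrace 1 {:L} l = c%:A.
Proof. exact/vlineP/(mem_galTrace galL)/memvf. Qed.

(** By Dedekind independence, the sum of the Galois automorphisms, all with coefficient 1, is not
    the zero map. A nonzero trace lies in [k], so its inverse can be moved inside the trace by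
    [k]-linearity. *)
Lemma galTrace_onto1 : exists l, galTrace 1 {:L} l = 1.
Proof.
have [] := @gal_independent_contra _ _ {:L}%AS
  (fun s => s \in 'Gal({:L} / 1)%g) (fun=> 1) 1%g (group1 _) (oner_neq0 L).
move=> l _; under eq_bigr do rewrite mul1r.
rewrite -/(galTrace 1 {:L} l) => tl0; have [c tlE] := galTrace_in_base l.
have c0 : c != 0 by apply: contraNneq tl0 => c0; rewrite tlE c0 scale0r.
exists (c^-1 *: l); rewrite /galTrace; under eq_bigr do rewrite linearZ /=.
by rewrite -scaler_sumr -/(galTrace 1 {:L} l) tlE scalerA mulVf // scale1r.
Qed.

Lemma sum_gal_act w :
  exists a, \sum_(s in 'Gal({:L} / 1)%g) gal_act s w = bc_in L a.
Proof.
elim/base_change_ind: w => [|x y [a IHa] [b IHb]|a l].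
- by exists 0; rewrite [RHS]ptens0l big1 // => s _; rewrite gal_act0.
- exists (a + b); rewrite [RHS]ptensDl -!/(bc_in L _) -IHa -IHb -big_split /=.
  by apply: eq_bigr => s _; rewrite gal_actD.
(* The sum is [a ⊗ Tr(l)] with [Tr(l) = c%:A]; as [c] lies in [k], it crosses the tensor sign and is
   absorbed into [a]. *)
have [c lE] := galTrace_in_base l; exists (c *: a).
have pure_sum (I : seq (gal_of {:L})) (P : pred (gal_of {:L})) :
    \sum_(s <- I | P s) gal_act s (a ⊗ l) =
      (a ⊗ (\sum_(s <- I | P s) s l) : base_change A L).
  rewrite (big_morph (fun x => a ⊗ x : tens A L) (ptensDr a) (ptens0r a)).
  by apply: eq_bigr => s _; rewrite gal_act_ptens.
by rewrite pure_sum -/(galTrace 1 {:L} l) lE ptens_scale_swap.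
Qed.

Lemma gal_invariants_bc_in w : gal_invariants L A w -> exists a, bc_in L a = w.
Proof.
move=> invw; have [l tl1] := galTrace_onto1.
have [a aE] := sum_gal_act (l *: w); exists a; rewrite -aE.
(* Semilinearity and the invariance of [w] leave only the coefficients [s l], which add up to the
   trace 1. *)
rewrite (eq_bigr (fun s : gal_of {:L} => s l *: w)).
  by rewrite -scaler_suml -/(galTrace 1 {:L} l) tl1 scale1r.
by move=> s Gs; rewrite gal_act_scale invw.
Qed.

Lemma center_bc_in a : center (base_change A L) (bc_in L a) <-> center A a.
Proof.
split=> [za b|za w]; first by apply: (@bc_in_inj _ _ L); rewrite !bc_in_mul za.
elim/base_change_ind: w => [|x y IHx IHy|b l]; first by rewrite mulr0 mul0r.
  by rewrite mulrDr mulrDl IHx IHy.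
(* The two products are [(a * b) ⊗ l] and [(b * a) ⊗ l], equal once [a] is central. *)
have := tens_mulp a b (1 : L) l; have := tens_mulp b a l (1 : L).
by rewrite mulr1 mul1r za => <-.
Qed.

(** Both sides are subsets of [base_change A L], with [A] identified with its image under the
    injective map [bc_in L]. *)
Lemma center_descent :
  bc_in L @` center A = center (base_change A L) `&` gal_invariants L A.
Proof.
apply/seteqP; split=> [_ [a za <-]|w [zw invw]].
  by split; [exact/center_bc_in|move=> s _; exact: gal_act_bc_in].
have [a aE] := gal_invariants_bc_in _ invw.
by exists a => //; apply/center_bc_in; rewrite aE.
Qed.

End GaloisDescent.

Theorem proposition1 (k : fieldType) (L : splittingFieldType k)
    (hL : galois 1 {:L}) (n : nat) (T : splitTorus L n) (Q : 'M[L]_n)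
    (hQ1 : forall i, Q i i = 1) (hQ : forall i j, Q i j * Q j i = 1)
    (A : quantumForm T Q) :
  bc_in L @` center A = center (base_change A L) `&` gal_invariants L A.
Proof. exact: center_descent. Qed.
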